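(* Let $X$ be a complete separable metric space and $\mu$ a Radon measure on $X$. Let $S\subset X$ be a Borel set and assume that for some $L>0$ and $\delta_0\in(0,1]$ and for each $m\in\mathbb N$ ($m\ge1$) there is an $L$-Lipschitz function $f_m\colon X\to\mathbb R$ such that: (1) There is a $\rho_m\in(0,\frac1m)$ such that if $B$ is a ball of radius $\rho_m$ centred at some point of $S$, the Lipschitz constant of the restriction $f_m|_B$ is at most $\frac1m$. (2) For each $x\in S$ there is $y\in B(x,\frac1m)$ such that $|f_m(x)-f_m(y)|\ge\delta_0\,d(x,y)>0$. Then for all $M\in\mathbb N$ ($M\ge1$) and all $\alpha\in\left(0,\min\left(\tfrac12\sqrt{\tfrac{\delta_0L}{1+\delta_0}},\tfrac12\delta_0\right)\right)$ there are a Borel subset $S'\subset S$ and Lipschitz functions $\{\psi_0,\dots,\psi_{M-1}\}$ such that: - The set $S\setminus S'$ is $\mu$-null. - The $\psi_i$ have Lipschitz constant bounded by $$3\left(L+\alpha+\frac{\alpha^2/L}{1-\alpha^2/L}(1+2^{-6}\alpha)\right).$$ - For each $x\in S'$ and all $(\lambda_0,\dots,\lambda_{M-1})\in\mathbb R^M$: $$\pounds\left(\sum_{i=0}^{M-1}\lambda_i\psi_i\right)(x)\ge\left(\delta_0-\frac{\alpha^2/L}{1-\alpha^2/L}-\alpha\right)\max_{i=0,\dots,M-1}|\lambda_i|.$$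
   Context: For $f\colon X\to\mathbb R$ Lipschitz, $\pounds f(x)=\limsup_{r\searrow0}\sup_{y\in B(x,r)}|f(x)-f(y)|/r$. *)

(* Defs.v *)
From HB Require Import structures.
From mathcomp Require Import all_boot all_order all_algebra.
From mathcomp Require Import all_classical all_reals all_analysis.

Set Implicit Arguments.
Unset Strict Implicit.
Unset Printing Implicit Defensive.

Import Order.TTheory GRing.Theory Num.Theory.
Import numFieldNormedType.Exports.

Local Open Scope classical_set_scope.
Local Open Scope ring_scope.

#[short(type="completeMetricType")]
HB.structure Definition CompleteMetric (R : numDomainType) :=
  {T of Complete T & Metric R T}.

Notation borel X := (g_sigma_algebraType (@open X)).

Definition separable (X : topologicalType) : Prop :=
  exists2 D : set X, countable D & dense D.

(* On a Polish space the usual definitions of a Radon measure agree: Borel,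
   locally finite and inner regular with respect to compact sets. *)
Definition radon_measure (R : realType) (X : completeMetricType R)
    (mu : set X -> \bar R) : Prop :=
  (forall x : X, exists U : set X, [/\ open U, U x & (mu U < +oo)%E]) /\
  (forall A : set X, measurable (A : set (borel X)) ->
     mu A = ereal_sup [set mu K | K in [set K | compact K /\ K `<=` A]]).

(* mathcomp-analysis's own k.-lipschitz_A f needs a normed module as domain. *)
Definition metric_lipschitz_on (R : realType) (X : metricType R)
    (k : R) (A : set X) (f : X -> R) : Prop :=
  forall x y : X, A x -> A y -> `|f x - f y| <= k * mdist x y.

(* Restricting to k >= 0 makes the constant 0, not -oo, when A has at most one
   point; it is +oo when the restriction of f to A is not Lipschitz. *)
Definition lipschitz_const (R : realType) (X : metricType R)
    (A : set X) (f : X -> R) : \bar R :=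
  ereal_inf [set k%:E | k in [set k : R | 0 <= k /\ metric_lipschitz_on k A f]].

Definition big_lip (R : realType) (X : metricType R) (f : X -> R) (x : X) :
    \bar R :=
  limf_esup
    (fun r : R => ereal_sup [set (`|f x - f y| / r)%:E | y in ball x r]) 0^'+.

(* Main.v *)
Require Import Defs.
From mathcomp Require Import all_boot all_order all_algebra.
From mathcomp Require Import all_classical all_reals all_analysis.
From mathcomp Require Import zify ring lra.

Set Implicit Arguments.
Unset Strict Implicit.
Unset Printing Implicit Defensive.

Import Order.TTheory GRing.Theory Num.Theory.
Import numFieldNormedType.Exports.

Local Open Scope classical_set_scope.
Local Open Scope ring_scope.

(** The functions psi_i are built by superposing layers. A layer of scale tau is
    a function G with values in [0, tau], supported in the tau-neighbourhood of
    S, L-Lipschitz everywhere and nearly constant at all scales below some rho,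
    such that every point of S outside a small exceptional set B has a witness
    at a distance between rho and tau along which G has slope delta0.

    A layer is obtained from one of the given functions f ([folded_layer]): f
    has the right behaviour near S, but it may be large. Composing it with a
    triangular wave of height at most h makes it bounded and preserves the
    differences of f between points whose values are not separated by a kink. A
    minimum with a decreasing function of the distance to S then makes it vanish
    away from S, at no cost in the Lipschitz constant. The points lost are those
    where f is within reach of a kink. Shifting the wave by multiples of 1/N of
    the distance between kinks gives N disjoint sets of lost points, so for a
    suitable shift the lost set has at most 1/N of the measure of any given set
    of finite measure ([layer_exists]); h can still be taken small because the
    reach of a kink is of the order of 1/m.

    Layers G_k are chosen inductively, with tau_(k+1) = kappa * rho_k. For a
    pair of points at distance d, coarse layers are flat and contribute at most
    2 * kappa * d in total, fine ones contribute at most 4 * kappa * d, and only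
    one layer remains ([other_layers_small]). Hence any
    sum of c_k * G_k with |c_k| <= 1 is Lipschitz with constant L + 6 * kappa,
    on all of X and not just on S, and at a witness for the layer k it has slope
    at least |c_k| * delta0 - 6 * kappa. Let psi_i be the sum of the G_k
    with k = i modulo M. A linear combination of the psi_i is a sum of this kind
    with c_k = lambda_(k mod M); looking at the k whose residue maximizes
    |lambda_i| gives slopes (delta0 - 6 * kappa) * max |lambda_i| at arbitrarily
    small scales.

    This works at every point of S that lies in only finitely many exceptional
    sets. As mu is sigma-finite ([locally_finite_exhaustion]) and the layer k is
    chosen so that its exceptional set has measure at most tau_k in the k-th set
    of an exhaustion of X, the Borel-Cantelli lemma shows that the other points
    of S form a null set. With kappa = alpha / 12 the constants are
    L + alpha / 2 and delta0 - alpha / 2. These imply the stated bounds, because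
    (alpha^2/L) / (1 - alpha^2/L) is positive. *)

(** * Folding the real line *)

Section Fold.
Variable R : realType.
Implicit Types (u v : R) (n : int).

(** The distance of a real number to the nearest integer: a triangular wave. *)
Definition int_dist u : R :=
  Num.min (u - (Num.floor u)%:~R) ((Num.floor u)%:~R + 1 - u).

Lemma int_dist_ge0 u : 0 <= int_dist u.
Proof.
have /andP[lo hi] := floor_itv u; move: hi; rewrite intrD => hi.
by rewrite /int_dist le_min; apply/andP; split; lra.
Qed.

Lemma int_dist_le1 u : int_dist u <= 1.
Proof.
have /andP[lo hi] := floor_itv u; move: hi; rewrite intrD => hi.
by rewrite /int_dist ge_min; apply/orP; left; lra.
Qed.

Lemma int_dist_le u n : int_dist u <= `|u - n%:~R|.
Proof.
have /andP[lo hi] := floor_itv u; move: hi; rewrite intrD => hi.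
rewrite /int_dist ge_min; case: (leP n (Num.floor u)) => [nu|un]; apply/orP.
  by left; have := ler_norm (u - n%:~R); rewrite -(ler_int R) in nu; lra.
right; rewrite distrC; have := ler_norm (n%:~R - u).
by rewrite -lezD1 -(ler_int R) intrD in un; lra.
Qed.

Lemma int_dist_attained u : exists n, int_dist u = `|u - n%:~R|.
Proof.
have /andP[lo hi] := floor_itv u; move: hi; rewrite intrD => hi.
rewrite /int_dist minEle; case: ifP => _.
  by exists (Num.floor u); rewrite ger0_norm//; lra.
by exists (Num.floor u + 1); rewrite intrD distrC ger0_norm//; lra.
Qed.

Lemma int_dist_lipschitz u v : `|int_dist u - int_dist v| <= `|u - v|.
Proof.
have wlog u' v' : int_dist u' - int_dist v' <= `|u' - v'|.
  have [n ->] := int_dist_attained v'.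
  have := int_dist_le u' n; have := ler_distD v' u' n%:~R; lra.
rewrite ler_norml wlog andbT; have := wlog v u; rewrite distrC; lra.
Qed.

(** The kinks of [int_dist] are the multiples of 1/2, so an interval that
    contains none of them is mapped isometrically. *)
Lemma int_dist_isometry (e : R) u v :
  e <= int_dist (2 * u) -> `|2 * u - 2 * v| <= e ->
  `|int_dist u - int_dist v| = `|u - v|.
Proof.
have /andP[lo hi] := floor_itv (2 * u); move: hi; rewrite intrD => hi.
rewrite {1}/int_dist le_min => /andP[]; set n := Num.floor (2 * u) => elo ehi.
rewrite ler_norml => /andP[vlo vhi].
have half_even t (p : int) : p%:~R <= t <= p%:~R + 1 / 2 ->
    int_dist t = t - p%:~R.
  move=> /andP[tlo thi].
  have -> : int_dist t = Num.min (t - p%:~R) (p%:~R + 1 - t).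
    by rewrite /int_dist (@floor_def _ t p)// intrD; apply/andP; split; lra.
  by apply/min_idPl; lra.
have half_odd t (p : int) : p%:~R + 1 / 2 <= t <= p%:~R + 1 ->
    int_dist t = p%:~R + 1 - t.
  move=> /andP[tlo thi]; have [tlt|tge] := ltP t (p%:~R + 1).
    have -> : int_dist t = Num.min (t - p%:~R) (p%:~R + 1 - t).
      by rewrite /int_dist (@floor_def _ t p)// intrD; apply/andP; split; lra.
    by apply/min_idPr; lra.
  have {tge thi}te : t = (p + 1)%:~R by rewrite intrD; lra.
  rewrite (half_even t (p + 1)) te; first by rewrite intrD; lra.
  by apply/andP; split; lra.
have [p [np|np]] : exists p : int, n%:~R = 2 * p%:~R :> R \/
    n%:~R = 2 * p%:~R + 1 :> R.
  exists (n %/ 2)%Z; have := divz_eq n 2.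
  have /andP : (0 <= (n %% 2)%Z) && ((n %% 2)%Z < 2).
    by rewrite modz_ge0// ltz_pmod.
  case: (n %% 2)%Z => [[|[|k]]|k] [] // _ _ e0; [left|right];
    by rewrite {1}e0 intrD intrM mulrC ?addr0.
- rewrite !(half_even _ p); [by congr `|_|; lra| |]; by apply/andP; split; lra.
- rewrite !(half_odd _ p); first by rewrite distrC; congr `|_|; lra.
  all: by apply/andP; split; lra.
Qed.

End Fold.

Lemma int_norm_lt1 (R : realType) (k : int) : `|k%:~R : R| < 1 -> k = 0.
Proof. by rewrite -intr_norm (ltr_int R _ 1); lia. Qed.

Lemma residue_inj (N a b : nat) (s : int) : (a < N)%N -> (b < N)%N ->
  a%:Z - b%:Z + s * N%:Z = 0 -> a = b.
Proof.
move=> aN bN; have [s_lt0|s_gt0|->] := ltrgtP s 0; last by rewrite mul0r; lia.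
  by have : s * N%:Z <= - 1 * N%:Z by [rewrite ler_wpM2r//; lia]; lia.
by have : 1 * N%:Z <= s * N%:Z by [rewrite ler_wpM2r//; lia]; lia.
Qed.

(** * Lipschitz functions and the distance to a set *)

Section Lipschitz.
Variables (R : realType) (X : metricType R).
Implicit Types (f g : X -> R) (A S : set X) (x y : X).

(** The infimum that defines the Lipschitz constant is attained, because the
    condition on [k] is closed. *)
Lemma lipschitz_constP (A : set X) f (k : R) : 0 <= k ->
  (lipschitz_const A f <= k%:E)%E <-> metric_lipschitz_on k A f.
Proof.
move=> k0; split=> [le_k x y Ax Ay|lipf]; last first.
  by apply: ereal_inf_lbound; exists k.
apply/ler_addgt0Pr => e e0; set d := mdist x y.
have d0 : 0 <= d by exact: mdist_ge0.
have d1 : 0 < d + 1 by lra.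
have : (lipschitz_const A f < (k + e / (d + 1))%:E)%E.
  by apply: le_lt_trans le_k _; rewrite lte_fin ltrDl divr_gt0.
move=> /ereal_inf_lt[_ [k' [_ lipf] <-]]; rewrite lte_fin => k'lt.
apply: le_trans (lipf _ _ Ax Ay) _.
apply: (@le_trans _ _ ((k + e / (d + 1)) * d)).
  by rewrite ler_wpM2r// ltW.
rewrite mulrDl lerD2l mulrAC ler_pdivrMr//; nra.
Qed.

Lemma lipschitz_min (k : R) f g :
  metric_lipschitz_on k setT f -> metric_lipschitz_on k setT g ->
  metric_lipschitz_on k setT (fun x => Num.min (f x) (g x)).
Proof.
move=> lf lg x y _ _; have := lf x y I I; have := lg x y I I.
rewrite !ler_norml => /andP[? ?] /andP[? ?]; rewrite !minEle.
by case: ifP => [|/negbT]; case: ifP => [|/negbT]; rewrite -?ltNge;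
  move=> ? ?; apply/andP; split; lra.
Qed.

Lemma lipschitz_lt_open (k : R) f (c : R) : metric_lipschitz_on k setT f ->
  open [set x | f x < c].
Proof.
move=> lf; rewrite openE => x /= fxc; rewrite /interior.
have k1 : 0 < `|k| + 1 by have := normr_ge0 k; lra.
have e0 : 0 < (c - f x) / (`|k| + 1) by rewrite divr_gt0// subr_gt0.
apply: filterS (nbhsx_ballx x _ e0) => y; rewrite ballEmdist/= => yx.
have := lf x y I I; rewrite distrC; have := ler_norm (f y - f x).
move: yx; rewrite ltr_pdivlMr//; have := mdist_ge0 x y; have := ler_norm k; nra.
Qed.

Lemma metric_ball_open x (r : R) : open (ball x r).
Proof.
rewrite ballEmdist; apply: (@lipschitz_lt_open 1) => y z _ _.
rewrite mul1r ler_norml; have := metric_triangle x y z.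
by have := metric_triangle x z y; rewrite (metric_sym z y); lra.
Qed.

(** On the empty set this is 0, the default value of an empty infimum; hence
    the hypothesis of nonemptiness in [set_dist_near]. *)
Definition set_dist S y : R := inf [set mdist y x | x in S].

Lemma set_dist_le S x y : S x -> set_dist S y <= mdist y x.
Proof.
move=> Sx; apply: ge_inf; last by exists x.
by exists 0 => _ [z _ <-]; exact: mdist_ge0.
Qed.

Lemma set_dist_near S y (e : R) : S !=set0 -> set_dist S y < e ->
  exists2 x, S x & mdist y x < e.
Proof.
move=> [z Sz] ye; have e0 : 0 < e - set_dist S y by rewrite subr_gt0.
have hi : has_inf [set mdist y x | x in S].
  split; first by exists (mdist y z), z.
  by exists 0 => _ [w _ <-]; exact: mdist_ge0.
have [_ [x Sx <-]] := inf_adherent e0 hi.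
by rewrite -/(set_dist S y) addrC subrK => ?; exists x.
Qed.

Lemma set_dist_ge0 S y : 0 <= set_dist S y.
Proof.
have [->|/set0P[z Sz]] := eqVneq S set0.
  by rewrite /set_dist image_set0 inf0.
apply: lb_le_inf; last by move=> _ [w _ <-]; exact: mdist_ge0.
by exists (mdist y z), z.
Qed.

Lemma set_dist_mem S x : S x -> set_dist S x = 0.
Proof.
move=> Sx; apply/eqP; rewrite eq_le set_dist_ge0 andbT.
by rewrite -(mdistxx x); exact: set_dist_le.
Qed.

Lemma set_dist_lipschitz S : metric_lipschitz_on 1 setT (set_dist S).
Proof.
have wlg x y : set_dist S x - set_dist S y <= mdist x y.
  have [->|/set0P S0] := eqVneq S set0.
    by rewrite /set_dist !image_set0 subrr mdist_ge0.
  apply/ler_addgt0Pr => e e0.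
  have [|z Sz yz] := @set_dist_near S y (set_dist S y + e) S0; first lra.
  by have := set_dist_le x Sz; have := metric_triangle x y z; lra.
move=> x y _ _; rewrite mul1r ler_norml wlg andbT.
by have := wlg y x; rewrite metric_sym; lra.
Qed.

End Lipschitz.

(** * Measure-theoretic ingredients *)

Section Measure.
Context {d : measure_display} {T : measurableType d} {R : realType}.
Variable mu : {measure set T -> \bar R}.

Lemma pigeonhole_measure (N : nat) (V : set T) (F : 'I_N -> set T) (tau : R) :
  measurable V -> (forall i, measurable (F i)) -> trivIset setT F ->
  (mu V < (N%:R * tau)%:E)%E -> exists i, (mu (V `&` F i) <= tau%:E)%E.
Proof.
move=> mV mF tF muV; apply: contrapT => /forallNP big.
have mVF i : measurable (V `&` F i) by exact: measurableI.
have mU : measurable (\big[setU/set0]_(i < N) (V `&` F i)).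
  by apply: bigsetU_measurable => i _; exact: mVF.
move: muV; apply/negP; rewrite -leNgt.
apply: (@le_trans _ _ (mu (\big[setU/set0]_(i < N) (V `&` F i)))); last first.
  apply: le_measure; rewrite ?inE//.
  by apply: (big_ind (fun A => A `<=` V)) => // A B AV BV; rewrite subUset.
rewrite measure_semi_additive_ord//; last exact: trivIset_setIl.
have -> : N%:R * tau = \sum_(i < N) tau.
  by rewrite sumr_const card_ord mulr_natl.
rewrite -sumEFin; apply: lee_sum => i _; rewrite leNgt; apply/negP => lt_i.
by apply: (big i); exact: ltW.
Qed.

End Measure.

Lemma borel_open (X : ptopologicalType) (A : set X) :
  open A -> measurable (A : set (borel X)).
Proof. by move=> oA; exact: sub_sigma_algebra. Qed.

(** A locally finite measure on a separable metric space is sigma-finite: the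
    balls of radius 1/n about a countable dense set that have finite measure
    already cover the space. *)
Lemma locally_finite_exhaustion (R : realType) (X : completeMetricType R)
    (mu : {measure set (borel X) -> \bar R}) :
  separable X ->
  (forall x : X, exists U : set X, [/\ open U, U x & (mu U < +oo)%E]) ->
  exists V : nat -> set X,
    [/\ forall k, measurable (V k : set (borel X)),
        forall k, (mu (V k) < +oo)%E &
        forall x, exists k0, forall k, (k0 <= k)%N -> V k x].
Proof.
move=> [D /pfcard_geP[->|[p]] denseD] finU.
  exists (fun=> set0); split=> // [k|x]; first by rewrite measure0.
  by have [] := denseD setT; [exists x|exact: openT|move=> y []].
pose B i n : set X := ball (p i) n.+1%:R^-1.
have oB i n : open (B i n) by exact: metric_ball_open.
pose W q : set X := if @unpickle (nat * nat)%type q is Some (i, n) then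
  if (mu (B i n) < +oo)%E then B i n else set0 else set0.
have mW q : measurable (W q : set (borel X)).
  rewrite /W; case: unpickle => [[i n]|]; last exact: measurable0.
  by case: ifP => _; [exact: borel_open|exact: measurable0].
have muW q : (mu (W q) < +oo)%E.
  rewrite /W; case: unpickle => [[i n]|]; last by rewrite measure0.
  by case: ifP => // _; rewrite measure0.
exists (fun k => \big[setU/set0]_(q < k) W q); split=> [k|k|x].
- by apply: bigsetU_measurable => q _; exact: mW.
- apply: (@le_lt_trans _ _ (\sum_(q < k) mu (W q))%E).
    by apply: Boole_inequality.
  by apply: lte_sum_pinfty => q _; exact: muW.
have [U [oU Ux muU]] := finU x.
have /nbhs_ballP[e /= e0 xeU] : nbhs x U by exact: open_nbhs_nbhs.
pose n := Num.trunc (2 / e).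
have ne : n.+1%:R^-1 < e / 2.
  by rewrite invf_plt ?posrE ?divr_gt0// invf_div; exact: truncnS_gt.
have n0 : 0 < n.+1%:R^-1 :> R by rewrite invr_gt0.
have [||c [/= xy]] := denseD (ball x n.+1%:R^-1).
- by exists x; exact: ballxx.
- exact: metric_ball_open.
move=> /(@surj _ _ _ _ p)[i _ ie]; rewrite -ie in xy.
have Bx : B i n x by exact: ball_sym.
have BU : B i n `<=` U.
  move=> z pz; apply: xeU; apply: le_ball (ball_triangle xy pz).
  by rewrite [leRHS]splitr lerD// ltW.
have muB : (mu (B i n) < +oo)%E.
  apply: le_lt_trans muU; apply: le_measure => //; rewrite inE;
  exact: borel_open.
exists (pickle (i, n)).+1 => k ik; rewrite -bigcup_mkord.
by exists (pickle (i, n)) => //; rewrite /W pickleK muB.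
Qed.

(** * One layer *)

(** A function that is steep near [S] at some scale between [rho] and [tau], yet
    flat below [rho] and at most [tau] everywhere. The premise of the flatness
    clause puts both points in one ball of radius [rho] centred on [S]; the
    points of [B] are exempt from the steepness clause. *)
Record oscillating_layer (R : realType) (X : metricType R) (S : set X)
    (L delta tau rho : R) (G : X -> R) (B : set X) : Prop := OscillatingLayer {
  layer_scale : 0 < rho < tau;
  layer_lipschitz : metric_lipschitz_on L setT G;
  layer_bounds : forall y, 0 <= G y <= tau;
  layer_support : forall y, tau <= set_dist S y -> G y = 0;
  layer_flat : forall y z, set_dist S y + mdist y z < rho ->
    `|G y - G z| <= tau * mdist y z;
  layer_oscillates : forall x, S x -> ~ B x -> exists y,
    [/\ rho <= mdist x y, mdist x y < tau &
        delta * mdist x y <= `|G x - G y|] }.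

Section OneLayer.
Variables (R : realType) (X : metricType R) (S : set X) (L delta : R).
Hypotheses (S_neq0 : S !=set0) (L_gt0 : 0 < L).

(** Folding [f] into a band of height [h] keeps its oscillation at every point
    whose value is not within reach of a kink of the fold, and the minimum with
    a decreasing function of the distance to [S] localizes the result to a
    neighbourhood of [S] without raising the Lipschitz constant [L]: a product
    with a cutoff would. *)
Lemma folded_layer (f : X -> R) (eps rho tau h e c : R) :
  metric_lipschitz_on L setT f ->
  0 < rho < eps ->
  (forall z, S z -> metric_lipschitz_on eps (ball z rho) f) ->
  (forall x, S x -> exists y, [/\ mdist x y < eps,
     delta * mdist x y <= `|f x - f y| & 0 < mdist x y]) ->
  eps < delta -> eps <= tau -> 0 < h <= tau -> h + L * eps <= L * tau ->
  2 * L * eps <= e * h ->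
  oscillating_layer S L delta tau rho
    (fun x => Num.min (h * int_dist (f x / h - c / 2))
                      (Num.max 0 (h + L * eps - L * set_dist S x)))
    [set x | int_dist (2 * f x / h - c) < e].
Proof.
move=> lipf /andP[rho0 rhoeps] flatf oscf epsd epst /andP[h0 ht] supp he.
have abs_hV : `|h^-1| = h^-1 by rewrite gtr0_norm ?invr_gt0.
set g := fun x => h * int_dist (f x / h - c / 2).
have g_dist x y : `|g x - g y| <= `|f x - f y|.
  rewrite /g -mulrBr normrM gtr0_norm// mulrC -ler_pdivlMr//.
  apply: le_trans (int_dist_lipschitz _ _) _.
  have -> : f x / h - c / 2 - (f y / h - c / 2) = (f x - f y) / h by field; lra.
  by rewrite normrM abs_hV.
have g_bounds x : 0 <= g x <= h.
  have := int_dist_ge0 (f x / h - c / 2).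
  have := int_dist_le1 (f x / h - c / 2).
  by rewrite /g => ? ?; apply/andP; split; nra.
(* on the eps-neighbourhood of S the cutoff is at least h, hence inactive *)
have cutoff_inactive x : set_dist S x <= eps ->
    Num.min (g x) (Num.max 0 (h + L * eps - L * set_dist S x)) = g x.
  move=> xS; apply/min_idPl; rewrite le_max; apply/orP; right.
  have /andP[_] := g_bounds x.
  by have : L * set_dist S x <= L * eps by [rewrite ler_pM2l]; lra.
split.
- by rewrite rho0 (lt_le_trans rhoeps).
- apply: lipschitz_min => x y _ _.
    by apply: le_trans (g_dist x y) _; exact: lipf.
  have : `|L * set_dist S x - L * set_dist S y| <= L * mdist x y.
    rewrite -mulrBr normrM gtr0_norm// ler_pM2l//.
    by have := @set_dist_lipschitz _ _ S x y I I; rewrite mul1r.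
  have := mulr_ge0 (ltW L_gt0) (mdist_ge0 x y).
  rewrite !ler_norml => ? /andP[? ?].
  rewrite !maxEle; case: ifP => [|/negbT]; case: ifP => [|/negbT];
    by rewrite -?ltNge => ? ?; apply/andP; split; lra.
- move=> y; have /andP[g_ge0 g_leh] := g_bounds y.
  rewrite le_min g_ge0 le_max lexx /=; apply: le_trans ht.
  by rewrite ge_min g_leh.
- move=> y ty; have /andP[g_ge0 _] := g_bounds y.
  have -> : Num.max 0 (h + L * eps - L * set_dist S y) = 0 :> R.
    apply/max_idPl; have : L * tau <= L * set_dist S y by rewrite ler_pM2l.
    by lra.
  exact/min_idPr.
- move=> y z yz.
  have [|x Sx xy] := @set_dist_near _ _ S y (rho - mdist y z) S_neq0.
    by rewrite ltrBrDr.
  have yx : mdist y x < rho by have := mdist_ge0 y z; lra.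
  have zx : mdist z x < rho.
    by have := metric_triangle z y x; rewrite (metric_sym z y); lra.
  have yS : set_dist S y <= eps by have := set_dist_le y Sx; lra.
  have zS : set_dist S z <= eps by have := set_dist_le z Sx; lra.
  rewrite !cutoff_inactive//.
  apply: le_trans (g_dist y z) _; apply: (@le_trans _ _ (eps * mdist y z)).
    by apply: (flatf x) => //; rewrite ballEmdist /= metric_sym.
  by rewrite ler_wpM2r// mdist_ge0.
- move=> x Sx /= /negP; rewrite -leNgt => ex.
  have [y [xy osc d0]] := oscf x Sx; exists y; split.
  + rewrite leNgt; apply/negP => yrho.
    have := flatf x Sx x y; rewrite !ballEmdist/= mdistxx => /(_ rho0 yrho).
    by nra.
  + exact: lt_le_trans epst.
  + have xS : set_dist S x <= eps by rewrite set_dist_mem//; lra.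
    have yS : set_dist S y <= eps.
      by have := set_dist_le y Sx; rewrite metric_sym; lra.
    rewrite !cutoff_inactive//.
    apply: le_trans osc _; rewrite le_eqVlt; apply/orP; left; apply/eqP.
    rewrite /g -mulrBr normrM gtr0_norm// (@int_dist_isometry _ e).
    * have -> : f x / h - c / 2 - (f y / h - c / 2) = (f x - f y) / h.
        by field; lra.
      by rewrite normrM abs_hV mulrC divfK ?gt_eqF.
    * have -> // : 2 * (f x / h - c / 2) = 2 * f x / h - c by field; lra.
    have -> : 2 * (f x / h - c / 2) - 2 * (f y / h - c / 2) =
        2 * (f x - f y) / h by field; lra.
    rewrite normrM abs_hV ler_pdivrMr//.
    rewrite normrM gtr0_norm//; apply: le_trans he.
    have := lipf x y I I; nra.
Qed.

End OneLayer.

(** The number [N] of shifts is dictated by the measure of [V]; only then is the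
    index [m] of the function to be folded chosen, large enough for the height
    [h], which is proportional to [N / m], to be less than [tau]. *)
Lemma layer_exists (R : realType) (X : completeMetricType R)
    (mu : {measure set (borel X) -> \bar R}) (S V : set X) (L delta tau : R) :
  S !=set0 -> measurable (V : set (borel X)) -> (mu V < +oo)%E ->
  0 < L -> 0 < delta -> 0 < tau ->
  (forall m : nat, (1 <= m)%N -> exists f : X -> R,
    [/\ metric_lipschitz_on L [set: X] f,
        exists rho : R, [/\ 0 < rho, rho < m%:R^-1 &
          forall z : X, S z ->
            (lipschitz_const (ball z rho) f <= (m%:R^-1)%:E)%E] &
        forall x : X, S x -> exists y : X,
          [/\ ball x m%:R^-1 y, delta * mdist x y <= `|f x - f y|
            & 0 < delta * mdist x y]]) ->
  exists rho G B, [/\ oscillating_layer S L delta tau rho G B,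
    measurable (B : set (borel X)) & (mu (V `&` B) <= tau%:E)%E].
Proof.
move=> S0 mV muV L0 d0 t0 hf.
pose N := (Num.trunc (fine (mu V) / tau)).+1.
have muVN : (mu V < (N%:R * tau)%:E)%E.
  rewrite -[mu V]fineK ?ge0_fin_numE// lte_fin -ltr_pdivrMr//.
  exact: truncnS_gt.
have N0 : 1 <= N%:R :> R by rewrite ler1n.
pose q : R := (4 * N%:R + 1) / tau + 4 * N%:R * L / tau + delta^-1.
pose m := (Num.trunc q).+1.
have mq : q < m%:R by exact: truncnS_gt.
have [f [lipf [rho [rho0 rhom flatf]] oscf]] := hf m isT.
pose eps : R := m%:R^-1.
have m0 : 0 < m%:R :> R by rewrite ltr0n.
have eps0 : 0 < eps by rewrite invr_gt0.
have [q1 q2 q3] : [/\ 0 < (4 * N%:R + 1) / tau, 0 < 4 * N%:R * L / tau &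
    0 < delta^-1].
  by rewrite invr_gt0 !divr_gt0 ?mulr_gt0//; lra.
have le_tau a : a / tau < m%:R -> a * eps <= tau.
  by rewrite ltr_pdivrMr// => am; rewrite ler_pdivrMr// mulrC ltW.
have eps1 : (4 * N%:R + 1) * eps <= tau by apply: le_tau; rewrite /q in mq; lra.
have eps2 : 4 * N%:R * L * eps <= tau by apply: le_tau; rewrite /q in mq; lra.
have epsd : eps < delta.
  by rewrite invf_plt ?posrE//; rewrite /q in mq; lra.
(* In the variable 2 f / h the kinks are 1 apart. Shifting the fold by multiples
   of 1/N there makes the exceptional sets, of values within 1/(2N) of a kink,
   disjoint, so one of them is small. *)
pose h := 4 * N%:R * L * eps; pose e : R := (2 * N%:R)^-1.
have h0 : 0 < h by rewrite !mulr_gt0//; lra.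
have [h_neq0 N_neq0] : h != 0 /\ N%:R != 0 :> R by rewrite gt_eqF ?pnatr_eq0.
have h2 : 0 < 2 / h by apply: divr_gt0.
have eN : e * N%:R = 1 / 2 by rewrite /e; field; rewrite N_neq0.
pose B (j : 'I_N) : set X := [set x | int_dist (2 * f x / h - j%:R / N%:R) < e].
have mB j : measurable (B j : set (borel X)).
  apply: borel_open; apply: (@lipschitz_lt_open _ X (2 * L / h)) => x y _ _.
  apply: le_trans (int_dist_lipschitz _ _) _.
  have -> : 2 * f x / h - j%:R / N%:R - (2 * f y / h - j%:R / N%:R) =
    2 / h * (f x - f y) by field; rewrite ?N_neq0 ?h_neq0.
  rewrite normrM gtr0_norm//.
  have -> : 2 * L / h * mdist x y = 2 / h * (L * mdist x y).
    by field; rewrite h_neq0.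
  by rewrite ler_wpM2l ?lipf// ltW.
have disjB : trivIset setT B.
  move=> a b _ _ [x [/= xa xb]]; apply/eqP; apply/negPn/negP => ab.
  have [p ep] := int_dist_attained (2 * f x / h - a%:R / N%:R).
  have [r er] := int_dist_attained (2 * f x / h - b%:R / N%:R).
  (* the integer a - b + (p - r) N cannot be 0 because 0 < |a - b| < N *)
  pose k : int := a%:Z - b%:Z + (p - r) * N%:Z.
  have kE : k%:~R = N%:R * ((2 * f x / h - b%:R / N%:R - r%:~R) -
      (2 * f x / h - a%:R / N%:R - p%:~R)) :> R.
    rewrite /k !(intrD, intrM, intrN) /= -!pmulrn.
    by field; rewrite ?N_neq0 ?h_neq0.
  have k1 : `|k%:~R| < 1 :> R.
    have N_gt0 : 0 < N%:R :> R by rewrite ltr0n.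
    have one_eq : N%:R * (2 * e) = 1 by rewrite /e; field; rewrite N_neq0.
    rewrite -[ltRHS]one_eq kE normrM gtr0_norm// ltr_pM2l//.
    rewrite [ltRHS]mulr_natl mulr2n.
    by apply: le_lt_trans (ler_normB _ _) _; rewrite -ep -er ltrD.
  have k0 : k = 0 := int_norm_lt1 k1.
  case/eqP: ab; apply: val_inj.
  exact: residue_inj (ltn_ord a) (ltn_ord b) k0.
have [j muj] := pigeonhole_measure mV mB disjB muVN.
exists rho, (fun x => Num.min (h * int_dist (f x / h - j%:R / N%:R / 2))
                      (Num.max 0 (h + L * eps - L * set_dist S x))), (B j).
split => //; apply: folded_layer => //.
- by rewrite rho0.
- by move=> z Sz; apply/lipschitz_constP; [exact: ltW|exact: flatf].
- move=> x /oscf[y []]; rewrite ballEmdist /= => ? ?.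
  by rewrite pmulr_rgt0// => ?; exists y.
- by nra.
- by rewrite h0.
- by rewrite /h; nra.
- by rewrite /h; nra.
Qed.

(** * Superposing layers at decreasing scales *)

Section Layers.
Variables (R : realType) (X : metricType R) (S : set X) (L delta kappa : R).
Variables (tau rho : nat -> R) (G : nat -> X -> R) (B : nat -> set X).
Hypotheses (kappa_gt0 : 0 < kappa) (kappa_le : kappa <= 1 / 2).
Hypothesis layers :
  forall k, oscillating_layer S L delta (tau k) (rho k) (G k) (B k).
Hypotheses (tau0 : tau 0 = kappa) (tauS : forall k, tau k.+1 = kappa * rho k).

Let rho_gt0 k : 0 < rho k.
Proof. by have /andP[] := layer_scale (layers k). Qed.
Let rho_lt k : rho k < tau k.
Proof. by have /andP[] := layer_scale (layers k). Qed.
Let tau_gt0 k : 0 < tau k. Proof. exact: lt_trans (rho_gt0 k) (rho_lt k). Qed.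

Let tauS_le k : tau k.+1 <= rho k / 2.
Proof. by rewrite tauS mulrC ler_pM2l//; have := kappa_le; lra. Qed.

Let tauS_half k : tau k.+1 <= tau k / 2.
Proof. by have := rho_lt k; have := tauS_le k; lra. Qed.

Lemma scale_le_inv k : tau k <= k.+1%:R^-1.
Proof.
elim: k => [|k IH]; first by rewrite tau0 invr1; have := kappa_le; lra.
apply: le_trans (tauS_half k) _; apply: (@le_trans _ _ (k.+1%:R^-1 / 2)).
  by rewrite ler_pM2r.
by rewrite -invfM lef_pV2 ?posrE ?mulr_gt0// -natrM ler_nat; lia.
Qed.

Lemma scale_antitone j k : (j <= k)%N -> tau k <= tau j.
Proof.
elim: k => [|k IH]; first by rewrite leqn0 => /eqP->.
rewrite leq_eqVlt => /predU1P[->//|/IH]; apply: le_trans.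
by have := tauS_half k; have := tau_gt0 k; lra.
Qed.

Lemma scale_sum_le m n : \sum_(m <= j < n) tau j <= 2 * tau m.
Proof.
have [nm|/ltnW mn] := leqP n m.
  by rewrite big_geq// mulr_ge0// ltW.
rewrite -(subnKC mn); move: (n - m)%N => l; elim: l m {mn} => [|l IH] m.
  by rewrite addn0 big_geq// mulr_ge0// ltW.
rewrite big_ltn ?addnS ?ltnS ?leq_addr//.
by have := IH m.+1; have := tauS_half m; rewrite addSn; lra.
Qed.

Let layer_diff j y z : `|G j y - G j z| <= tau j.
Proof.
have /andP[? ?] := layer_bounds (layers j) y.
have /andP[? ?] := layer_bounds (layers j) z.
by rewrite ler_norml; apply/andP; split; lra.
Qed.

(** For a given pair of points only one layer matters. The coarser ones are flat
    there, with slopes that sum to at most [2 * kappa]. The finer ones either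
    have a total height of at most [4 * kappa * mdist y z] or vanish at both
    points, according to whether [mdist y z] or the distance to [S] is
    responsible for leaving the flat zone of layer [k]. *)
Lemma other_layers_small y z k n : set_dist S y <= set_dist S z ->
  (forall j, (j < k)%N -> set_dist S y + mdist y z < rho j) ->
  rho k <= set_dist S y + mdist y z -> (k < n)%N ->
  \sum_(0 <= j < n | j != k) `|G j y - G j z| <= 6 * kappa * mdist y z.
Proof.
move=> yz lt_rho rho_le kn; have d0 := mdist_ge0 y z.
rewrite (@big_cat_nat _ _ _ k)//=; last exact: ltnW.
rewrite (@big_ltn_cond _ _ _ k)// eqxx /=.
have low : \sum_(0 <= j < k | j != k) `|G j y - G j z| <= 2 * kappa * mdist y z.
  apply: (@le_trans _ _ (\sum_(0 <= j < k) tau j * mdist y z)).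
    rewrite big_mkcond /=; apply: ler_sum_nat => j /andP[_ jk].
    by rewrite ltn_eqF//=; apply: layer_flat (layers j) _ _ (lt_rho j jk).
  by rewrite -mulr_suml ler_wpM2r// -tau0; exact: scale_sum_le.
suff high : \sum_(k.+1 <= j < n | j != k) `|G j y - G j z| <=
    4 * kappa * mdist y z by lra.
have [d_big|d_small] := leP (rho k / 2) (mdist y z).
  apply: (@le_trans _ _ (\sum_(k.+1 <= j < n) tau j)).
    rewrite big_mkcond /=; apply: ler_sum_nat => j /andP[kj _].
    by rewrite gtn_eqF//=; exact: layer_diff.
  apply: le_trans (scale_sum_le _ _) _; rewrite tauS.
  have : kappa * rho k <= kappa * (2 * mdist y z) by rewrite ler_pM2l//; lra.
  by lra.
rewrite big1_seq => [|j /andP[_]]; first by rewrite !mulr_ge0// ltW.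
rewrite mem_index_iota => /andP[kj _].
have tauj : tau j <= set_dist S y.
  by apply: le_trans (scale_antitone kj) _; have := tauS_le k; lra.
rewrite !(layer_support (layers j)) ?subrr ?normr0//; exact: le_trans yz.
Qed.

(** The layer to be singled out for a pair of points is the coarsest one that is
    not known to be flat on it. *)
Lemma critical_layer (D : R) : 0 < D ->
  exists2 k, (forall j, (j < k)%N -> D < rho j) & rho k <= D.
Proof.
move=> D0; have ex_k : exists k, rho k <= D.
  exists (Num.trunc D^-1); apply: le_trans (ltW (rho_lt _)) _.
  apply: le_trans (scale_le_inv _) _.
  by rewrite invf_ple ?posrE//; apply: ltW; exact: truncnS_gt.
exists (ex_minn ex_k); case: ex_minnP => k // rk min_k j jk.
by rewrite ltNge; apply/negP => /min_k; rewrite leqNgt jk.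
Qed.

Section Superposition.
Variables (c : nat -> R) (Lambda : R) (F : X -> R).
Hypothesis c_le : forall j, `|c j| <= Lambda.
Hypothesis cvgF : forall y,
  (fun n => \sum_(0 <= j < n) c j * G j y) @ \oo --> F y.

Lemma superposition_single y z k : set_dist S y <= set_dist S z ->
  (forall j, (j < k)%N -> set_dist S y + mdist y z < rho j) ->
  rho k <= set_dist S y + mdist y z ->
  `|F y - F z - c k * (G k y - G k z)| <= Lambda * (6 * kappa * mdist y z).
Proof.
move=> yz lt_rho rho_le.
have cvgD : (fun n => `|\sum_(0 <= j < n) c j * G j y -
    \sum_(0 <= j < n) c j * G j z - c k * (G k y - G k z)|) @ \oo -->
    `|F y - F z - c k * (G k y - G k z)|.
  by apply: cvg_norm; apply: cvgB; [apply: cvgB; exact: cvgF|exact: cvg_cst].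
apply: (ler_cvg_to cvgD (@cvg_cst _ _ _ _ _)).
exists k.+1 => //= n kn.
have Lambda0 : 0 <= Lambda := le_trans (normr_ge0 _) (c_le 0).
apply: le_trans (ler_wpM2l Lambda0 (other_layers_small yz lt_rho rho_le kn)).
have -> : \sum_(0 <= j < n) c j * G j y - \sum_(0 <= j < n) c j * G j z -
    c k * (G k y - G k z) = \sum_(0 <= j < n | j != k) c j * (G j y - G j z).
  rewrite -sumrB (bigD1_seq k) ?iota_uniq ?mem_index_iota//=.
  by rewrite mulrBr addrAC subrr add0r; apply: eq_bigr => j _; rewrite mulrBr.
apply: le_trans (ler_norm_sum _ _ _) _; rewrite mulr_sumr.
by apply: ler_sum => j _; rewrite normrM ler_wpM2r.
Qed.

(** The critical layer contributes at most [L * mdist y z] and all the others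
    together at most [6 * kappa * mdist y z]. *)
Lemma superposition_lipschitz :
  metric_lipschitz_on (Lambda * (L + 6 * kappa)) setT F.
Proof.
have Lambda0 : 0 <= Lambda := le_trans (normr_ge0 _) (c_le 0).
move=> y z _ _; wlog yz : y z / set_dist S y <= set_dist S z => [wlg|].
  have [/wlg//|/ltW/wlg] := leP (set_dist S y) (set_dist S z).
  by rewrite distrC metric_sym.
have [->|neq_yz] := eqVneq y z; first by rewrite subrr normr0 mdistxx mulr0.
have [|k lt_rho rho_le] := @critical_layer (set_dist S y + mdist y z).
  by rewrite ltr_wpDl ?set_dist_ge0// mdist_gt0.
have := superposition_single yz lt_rho rho_le.
have lipG := @layer_lipschitz _ _ _ _ _ _ _ _ _ (layers k) y z I I.
have : `|c k * (G k y - G k z)| <= Lambda * (L * mdist y z).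
  by rewrite normrM ler_pM.
have := ler_normD (F y - F z - c k * (G k y - G k z)) (c k * (G k y - G k z)).
rewrite subrK; set a := mdist y z; lra.
Qed.

(** A witness for the layer [k] is at a distance between [rho k] and [tau k],
    which is less than [rho j] for every [j < k]: the critical layer for this
    pair is the layer [k] itself, and the others cannot cancel its slope. *)
Lemma superposition_oscillates x k : S x -> ~ B k x -> `|c k| = Lambda ->
  exists2 y, mdist x y < tau k &
    Lambda * ((delta - 6 * kappa) * mdist x y) <= `|F x - F y|
    /\ 0 < mdist x y.
Proof.
move=> Sx Bx ck.
have [y [rho_le lt_tau osc]] := layer_oscillates (layers k) Sx Bx.
exists y => //; split; last exact: lt_le_trans (rho_gt0 k) rho_le.
have x0 : set_dist S x = 0 := set_dist_mem Sx.
have lt_rho j : (j < k)%N -> set_dist S x + mdist x y < rho j.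
  move=> jk; rewrite x0 add0r; apply: lt_le_trans lt_tau _.
  apply: le_trans (scale_antitone jk) _.
  by have := tauS_le j; have := rho_gt0 j; lra.
have single := @superposition_single x y k.
rewrite x0 add0r set_dist_ge0 in single.
have {}single := single isT _ rho_le.
have := ler_normB (F x - F y) (F x - F y - c k * (G k x - G k y)).
rewrite subKr normrM ck.
have : Lambda * (delta * mdist x y) <= Lambda * `|G k x - G k y|.
  by rewrite ler_wpM2l// -ck.
have := single _; rewrite x0 add0r in lt_rho; move=> /(_ lt_rho).
by set a := mdist x y; lra.
Qed.

End Superposition.

Lemma superposition_is_cvg (c : nat -> R) y : (forall j, 0 <= c j <= 1) ->
  cvgn (fun n => \sum_(0 <= j < n) c j * G j y).
Proof.
move=> c01; have G0 j : 0 <= c j * G j y <= tau j.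
  have /andP[? ?] := c01 j; have /andP[? ?] := layer_bounds (layers j) y.
  by apply/andP; split; nra.
apply: nondecreasing_is_cvgn.
  apply/nondecreasing_seqP => n; rewrite big_nat_recr//= lerDl.
  by have /andP[] := G0 n.
exists (2 * tau 0) => _ [n _ <-]; apply: le_trans (scale_sum_le 0 n).
by apply: ler_sum => j _; have /andP[] := G0 j.
Qed.

End Layers.

(** * Conclusion *)

(** The radius [r] may exceed the distance to the witness [y]: the balls are
    open, so [y] is not in the ball of radius [mdist x y] about [x]. *)
Lemma big_lip_ge (R : realType) (X : metricType R) (f : X -> R) (x : X)
    (a : R) :
  (forall e : R, 0 < e -> exists r y,
    [/\ 0 < r < e, mdist x y < r & a * r <= `|f x - f y|]) ->
  (a%:E <= big_lip f x)%E.
Proof.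
move=> near_a; rewrite /big_lip limf_esupE.
apply: le_ereal_inf_tmp => _ [V V0 <-].
have /nbhs_ballP[e /= e0 eV] := V0.
have [r [y [/andP[r0 re] xyr ar]]] := near_a e e0.
have Vr : V r by apply: eV => //; rewrite /ball /= sub0r normrN gtr0_norm.
apply: le_trans (ereal_sup_ubound (ex_intro2 _ _ r Vr erefl)).
apply: le_trans (ereal_sup_ubound (ex_intro2 _ _ y _ erefl)); last first.
  by rewrite ballEmdist.
by rewrite lee_fin ler_pdivlMr.
Qed.

Theorem theorem4p18 (R : realType) (X : completeMetricType R)
    (sepX : separable X)
    (mu : {measure set (borel X) -> \bar R}) (radon_mu : radon_measure mu)
    (S : set X) (borelS : measurable (S : set (borel X)))
    (L delta0 : R) (L_gt0 : 0 < L) (delta0_gt0 : 0 < delta0)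
    (delta0_le1 : delta0 <= 1)
    (hf : forall m : nat, (1 <= m)%N ->
      exists f : X -> R,
        [/\ metric_lipschitz_on L [set: X] f,
            exists rho : R, [/\ 0 < rho, rho < m%:R^-1 &
              forall z : X, S z ->
                (lipschitz_const (ball z rho) f <= (m%:R^-1)%:E)%E] &
            forall x : X, S x ->
              exists y : X, [/\ ball x m%:R^-1 y,
                delta0 * mdist x y <= `|f x - f y| & 0 < delta0 * mdist x y]])
    (M : nat) (M_ge1 : (1 <= M)%N)
    (alpha : R) (alpha_gt0 : 0 < alpha)
    (alpha_lt : alpha < Num.min (2^-1 * Num.sqrt (delta0 * L / (1 + delta0)))
                                (2^-1 * delta0)) :
  exists (S' : set X) (psi : 'I_M -> X -> R),
    [/\ measurable (S' : set (borel X)) /\ S' `<=` S,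
        mu (S `\` S') = 0%E,
        forall i : 'I_M,
          (lipschitz_const [set: X] (psi i) <=
            (3 * (L + alpha + (alpha ^+ 2 / L) / (1 - alpha ^+ 2 / L)
                              * (1 + 2 ^- 6 * alpha)))%:E)%E &
        forall x : X, S' x -> forall lambda : 'I_M -> R,
          (((delta0 - (alpha ^+ 2 / L) / (1 - alpha ^+ 2 / L) - alpha)
            * \big[Num.max/0]_(i < M) `|lambda i|)%:E
           <= big_lip (fun z => (\sum_(i < M) lambda i * psi i z)%R) x)%E].

Proof.
move: alpha_lt; rewrite lt_min => /andP[alpha_sqrt alpha_half].
have ratio_gt0 : 0 < delta0 * L / (1 + delta0).
  by rewrite divr_gt0 ?mulr_gt0//; lra.
set t := alpha ^+ 2 / L.
have t0 : 0 < t by rewrite divr_gt0// exprn_gt0.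
have t1 : t < 1 / 4.
  have : alpha ^+ 2 < (2^-1 * Num.sqrt (delta0 * L / (1 + delta0))) ^+ 2.
    by rewrite ltr_pXn2r// nnegrE ?mulr_ge0 ?sqrtr_ge0// ltW.
  rewrite exprMn sqr_sqrtr ?ltW// => a2; rewrite /t ltr_pdivrMr//.
  apply: lt_le_trans a2 _; rewrite expr2.
  have : delta0 * L / (1 + delta0) <= L.
    by rewrite ler_pdivrMr; last lra; nra.
  by lra.
have eta0 : 0 < t / (1 - t) by rewrite divr_gt0//; lra.
set eta := t / (1 - t) in eta0 *.
have [S0|/set0P S0] := eqVneq S set0.
  exists set0, (fun _ _ => 0); split=> [||i|x []].
  - by split; [exact: measurable0|exact: sub0set].
  - by rewrite S0 setD0 measure0.
  - apply/lipschitz_constP; first by rewrite !mulr_ge0//; nra.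
    move=> x y _ _; rewrite subrr normr0 mulr_ge0// ?mdist_ge0//.
    by rewrite mulr_ge0//; nra.
have [V [mV muV exhV]] := locally_finite_exhaustion sepX radon_mu.1.
have step (kt : nat * R) : exists rGB : R * (X -> R) * set X, 0 < kt.2 ->
    [/\ oscillating_layer S L delta0 kt.2 rGB.1.1 rGB.1.2 rGB.2,
        measurable (rGB.2 : set (borel X)) &
        (mu (V kt.1 `&` rGB.2) <= kt.2%:E)%E].
  have [t_gt0|/negP nt] := boolP (0 < kt.2); last first.
    by exists (0, (fun=> 0), set0).
  have [rho [G [B lay]]] :=
    layer_exists S0 (mV kt.1) (muV kt.1) L_gt0 delta0_gt0 t_gt0 hf.
  by exists (rho, G, B).
have [layer_of layerP] := choice step.
(* a twelfth of alpha, so that the error 6 * kappa is half of alpha *)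
pose kappa := alpha / 12.
have kappa0 : 0 < kappa by rewrite /kappa; lra.
have kappa_half : kappa <= 1 / 2 by rewrite /kappa; lra.
pose tau k := iteri k (fun j s => kappa * (layer_of (j, s)).1.1) kappa.
pose rho k := (layer_of (k, tau k)).1.1.
pose G k := (layer_of (k, tau k)).1.2.
pose B k := (layer_of (k, tau k)).2.
have tauS k : tau k.+1 = kappa * rho k by [].
have tau_gt0 k : 0 < tau k.
  elim: k => // k IH; rewrite tauS mulr_gt0//.
  by have [lay _ _] := layerP (k, tau k) IH; have /andP[] := layer_scale lay.
have layers k : oscillating_layer S L delta0 (tau k) (rho k) (G k) (B k).
  by have [] := layerP (k, tau k) (tau_gt0 k).
have mB k : measurable (B k : set (borel X)).
  by have [] := layerP (k, tau k) (tau_gt0 k).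
have muB k : (mu (V k `&` B k) <= (tau k)%:E)%E.
  by have [] := layerP (k, tau k) (tau_gt0 k).
pose bad k : set (borel X) := V k `&` B k.
have mbad k : measurable (bad k) by exact: measurableI.
have bad0 : mu (lim_sup_set bad) = 0%E.
  apply: lim_sup_set_cvg0 => //.
  apply: (@le_lt_trans _ _ (2 * tau 0)%:E); last exact: ltry.
  apply: lime_le; first by apply: is_cvg_nneseries => n _ _; exact: measure_ge0.
  apply: nearW => n; apply: (@le_trans _ _ (\sum_(0 <= k < n) (tau k)%:E)%E).
    by apply: lee_sum => k _; exact: muB.
  by rewrite sumEFin lee_fin; exact: (scale_sum_le kappa_half layers tauS).
have mlim : measurable (lim_sup_set bad).
  by apply: bigcapT_measurable => n; exact: bigcup_measurable.
pose cls (j : nat) : 'I_M := Ordinal (ltn_pmod j M_ge1).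
pose psi i y := limn (fun n => \sum_(0 <= j < n) (cls j == i)%:R * G j y).
have psi_cvg i y :
    (fun n => \sum_(0 <= j < n) (cls j == i)%:R * G j y) @ \oo --> psi i y.
  apply: (superposition_is_cvg kappa_half layers tauS) => j.
  by case: (cls j == i); rewrite ?lexx ?ler01.
exists (S `\` lim_sup_set bad), psi; split.
- by split; [exact: measurableD|exact: subDsetl].
- apply/eqP; rewrite eq_le measure_ge0 andbT -bad0.
  apply: le_measure; rewrite ?inE//; last first.
    by rewrite setDD; exact: subIsetr.
  by apply: measurableD => //; exact: measurableD.
- move=> i; apply/lipschitz_constP; first by rewrite mulr_ge0//; nra.
  have c1 j : `|(cls j == i)%:R : R| <= 1 by case: eqP; rewrite ?normr1 ?normr0.
  have lip_psi := @superposition_lipschitz _ _ _ _ _ _ _ _ _ _ kappa0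
    kappa_half layers erefl tauS _ _ _ c1 (psi_cvg i).
  move=> x y Xx Xy; apply: le_trans (lip_psi x y I I) _.
  by rewrite ler_wpM2r ?mdist_ge0// mul1r /kappa; nra.
move=> x [Sx good_x] lambda; set Lambda := \big[_/_]_(i < M) _.
pose F z := \sum_(i < M) lambda i * psi i z.
have cvgF z : (fun n => \sum_(0 <= j < n) lambda (cls j) * G j z) @ \oo --> F z.
  have -> : (fun n => \sum_(0 <= j < n) lambda (cls j) * G j z) =
      (fun n => \sum_(i < M) lambda i *
        \sum_(0 <= j < n) (cls j == i)%:R * G j z).
    apply/funext => n; under [RHS]eq_bigr do rewrite mulr_sumr.
    rewrite exchange_big /=; apply: eq_bigr => j _.
    rewrite (bigD1 (cls j))//= eqxx mul1r big1 ?addr0// => i /negPf.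
    by rewrite eq_sym => ->; rewrite mul0r mulr0.
  apply: cvg_big => [|i _]; first exact: add_continuous.
  exact: cvgMr (psi_cvg i z).
have lambda_le j : `|lambda (cls j)| <= Lambda.
  exact: (le_bigmax 0 (fun i => `|lambda i|) (cls j)).
have [i0 lambda_max] : exists i0, `|lambda i0| = Lambda.
  pose i1 := cls 0.
  rewrite /Lambda (@bigmax_eq_arg _ _ _ 0 i1)//; first by eexists.
have [n0 good] : exists n0, forall k, (n0 <= k)%N -> ~ B k x.
  have [k1 Vx] := exhV x.
  move: good_x => /existsNP[n /not_implyP[_ nbad]].
  exists (maxn n k1) => k; rewrite geq_max => /andP[nk k1k] Bkx.
  by apply: nbad; exists k => //; split=> //; exact: Vx.
have Lambda0 : 0 <= Lambda := le_trans (normr_ge0 _) (lambda_le 0).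
have dalpha : 0 < delta0 - alpha by lra.
(* the radius is d(x, y) times the ratio of the slope delta0 - alpha / 2 that is
   attained to the slope delta0 - alpha that suffices; it is at most 2 *)
pose q := (delta0 - alpha / 2) / (delta0 - alpha).
have q1 : 1 < q by rewrite ltr_pdivlMr//; lra.
have q2 : q <= 2 by rewrite ler_pdivrMr//; lra.
apply: big_lip_ge => e e0.
pose n1 := Num.trunc (2 / e).
pose k := (maxn n0 n1 * M + i0)%N.
have n_le_k : (maxn n0 n1 <= k)%N.
  by apply: leq_trans (leq_addr _ _); rewrite leq_pmulr.
have [n0k n1k] : (n0 <= k)%N /\ (n1 <= k)%N by apply/andP; rewrite -geq_max.
have clsk : cls k = i0.
  by apply: val_inj; rewrite /= modnMDl modn_small.
have tau_small : tau k < e / 2.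
  have tau_inv := scale_le_inv kappa0 kappa_half layers erefl tauS k.
  apply: le_lt_trans tau_inv _.
  rewrite invf_plt ?posrE ?divr_gt0// invf_div.
  by apply: lt_le_trans (truncnS_gt _) _; rewrite ler_nat.
have [y y_tau [osc d0]] := superposition_oscillates kappa0
  kappa_half layers erefl tauS lambda_le cvgF Sx (good k n0k)
  (etrans (congr1 (fun i => `|lambda i|) clsk) lambda_max).
exists (mdist x y * q), y; split.
- by apply/andP; split; [rewrite mulr_gt0//|]; nra.
- by nra.
apply: le_trans osc; rewrite [_ * Lambda]mulrC -mulrA ler_wpM2l//.
have -> : delta0 - 6 * kappa = (delta0 - alpha) * q.
  by rewrite /q [RHS]mulrC divfK ?gt_eqF// /kappa; lra.
rewrite -[leRHS]mulrA (mulrC q) ler_wpM2r//; last by lra.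
by rewrite mulr_ge0// ltW//; lra.
Qed.
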